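(* Let $\mathbb{T}_1,\mathbb{T}_2,\mathbb{T}_3$ be time scales and let $a_i<b_i$ be points of $\mathbb{T}_i$ for $i=1,2,3$. Let $f,g:[a_1,b_1]\times[a_2,b_2]\times[a_3,b_3]\to\mathbb{R}$ be rd-continuous functions such that $f^{\Delta_3\Delta_2\Delta_1}$ and $g^{\Delta_3\Delta_2\Delta_1}$ exist, are rd-continuous and are bounded. Let $s\in[a_1,b_1)$, $t\in[a_2,b_2)$, $\tau\in[a_3,b_3)$ (points of $\mathbb{T}_1,\mathbb{T}_2,\mathbb{T}_3$ respectively). Then $$\int_{\sigma_1(s)}^{b_1}\int_{\sigma_2(t)}^{b_2}\int_{\sigma_3(\tau)}^{b_3}\Big[f(x,y,z)g(x,y,z)-\tfrac12\big[f(x,y,z)\,A(g(x,y,z))+g(x,y,z)\,A(f(x,y,z))\big]\Big]\Delta_3z\,\Delta_2y\,\Delta_1x$$ $$\le \frac1{16}\,(b_1-\sigma_1(s))(b_2-\sigma_2(t))(b_3-\sigma_3(\tau))\int_{\sigma_1(s)}^{b_1}\int_{\sigma_2(t)}^{b_2}\int_{\sigma_3(\tau)}^{b_3}\Big[|g(x,y,z)|\,\|f^{\Delta_3\Delta_2\Delta_1}\|_\infty+|f(x,y,z)|\,\|g^{\Delta_3\Delta_2\Delta_1}\|_\infty\Big]\Delta_3z\,\Delta_2y\,\Delta_1x,$$ where, for $h\in\{f,g\}$, $$\begin{aligned} A(h(x,y,z))={}&\tfrac18\big[h(\sigma_1(s),\sigma_2(t),\sigma_3(\tau))+h(b_1,b_2,b_3)+h(\sigma_1(s),\sigma_2(t),b_3)+h(\sigma_1(s),b_2,\sigma_3(\tau))\\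 &\quad+h(b_1,\sigma_2(t),\sigma_3(\tau))+h(\sigma_1(s),b_2,b_3)+h(b_1,b_2,\sigma_3(\tau))+h(b_1,\sigma_2(t),b_3)\big]\\ &-\tfrac14\big[h(x,\sigma_2(t),\sigma_3(\tau))+h(x,b_2,b_3)+h(x,b_2,\sigma_3(\tau))+h(x,\sigma_2(t),b_3)\big]\\ &-\tfrac14\big[h(\sigma_1(s),y,\sigma_3(\tau))+h(b_1,y,b_3)+h(\sigma_1(s),y,b_3)+h(b_1,y,\sigma_3(\tau))\big]\\ &-\tfrac14\big[h(\sigma_1(s),\sigma_2(t),z)+h(b_1,b_2,z)+h(b_1,\sigma_2(t),z)+h(\sigma_1(s),b_2,z)\big]\\ &+\tfrac12\big[h(\sigma_1(s),y,z)+h(b_1,y,z)\big]+\tfrac12\big[h(x,\sigma_2(t),z)+h(x,b_2,z)\big]+\tfrac12\big[h(x,y,\sigma_3(\tau))+h(x,y,b_3)\big]. \end{aligned}$$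
   Context: A time scale is a nonempty closed subset $\mathbb{T}$ of $\mathbb{R}$. Its forward and backward jump operators are $\sigma(t)=\inf\{r\in\mathbb{T}:r>t\}$ and $\rho(t)=\sup\{r\in\mathbb{T}:r<t\}$ (with $\sigma(\max\mathbb{T})=\max\mathbb{T}$ and $\rho(\min\mathbb{T})=\min\mathbb{T}$ when these exist). A point $t$ is right-dense if $t<\sup\mathbb{T}$ and $\sigma(t)=t$, left-dense if $t>\inf\mathbb{T}$ and $\rho(t)=t$, left-scattered if $\rho(t)<t$. For three time scales $\mathbb{T}_1,\mathbb{T}_2,\mathbb{T}_3$, $\sigma_i$ and $\Delta_i$ denote the forward jump operator and delta differentiation on $\mathbb{T}_i$. Intervals $[a_i,b_i]$, $[a_i,b_i)$ are intersected with $\mathbb{T}_i$. The partial delta derivative $f^{\Delta_1}(t_1,t_2,t_3)$ is the number such that for every $\varepsilon>0$ there is a neighbourhood $U$ of $t_1$ in $\mathbb{T}_1$ with $|f(\sigma_1(t_1),t_2,t_3)-f(r,t_2,t_3)-f^{\Delta_1}(t_1,t_2,t_3)(\sigma_1(t_1)-r)|\le\varepsilon|\sigma_1(t_1)-r|$ for all $r\in U$; $f^{\Delta_2},f^{\Delta_3}$ are defined analogously in the second and third variables. $f^{\Delta_3\Delta_2\Delta_1}$ is the mixed derivative $\frac{\partial^3 f}{\Delta_3 z\,\Delta_2 y\,\Delta_1 x}$, obtained by delta differentiating first in the first variable, then in the second, then in the third. As usual, delta derivatives in the $i$-th variable are considered on $[a_i,b_i]^\kappa$, i.e. $[a_i,b_i]$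 with $b_i$ removed if $b_i$ is left-scattered. A function of one variable on a time scale is rd-continuous if it is continuous at right-dense points and has finite left-sided limits at left-dense points. For functions of three variables the usual multivariable version is meant: for every point $p=(p_1,p_2,p_3)$ and every $L\subseteq\{1,2,3\}$ such that $p_i$ is left-dense for all $i\in L$, the finite limit of $f(q)$ exists as $q\to p$ with $q_i<p_i$ for $i\in L$ and $q_i\ge p_i$ for $i\notin L$, and this limit equals $f(p)$ whenever $p_i$ is right-dense for all $i\in L$ (in particular when $L=\emptyset$). Integrals are (iterated) delta integrals. $\|h\|_\infty$ denotes the supremum of $|h|$ over its domain. *)

(* Defs.v *)
From HB Require Import structures.
From mathcomp Require Import all_boot all_order all_algebra.
From mathcomp Require Import all_classical all_reals all_analysis.
Set Implicit Arguments.
Unset Strict Implicit.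
Unset Printing Implicit Defensive.
Import Order.TTheory GRing.Theory Num.Theory.
Import numFieldNormedType.Exports.
Local Open Scope classical_set_scope.
Local Open Scope ring_scope.

Definition time_scale (R : realType) (T : set R) : Prop :=
  T !=set0 /\ closed T.

(* The test selects the convention sigma (max T) = max T (and dually for rho);
   without it, [inf set0] would be the default value 0. *)
Definition sigma (R : realType) (T : set R) (t : R) : R :=
  if `[< exists2 r, T r & t < r >] then inf [set r | T r /\ t < r] else t.

Definition rho (R : realType) (T : set R) (t : R) : R :=
  if `[< exists2 r, T r & r < t >] then sup [set r | T r /\ r < t] else t.

(* T may be unbounded, so sup T and inf T are taken in the extended reals. *)
Definition right_dense (R : realType) (T : set R) (t : R) : Prop :=
  (t%:E < ereal_sup (EFin @` T))%E /\ sigma T t = t.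

Definition left_dense (R : realType) (T : set R) (t : R) : Prop :=
  (ereal_inf (EFin @` T) < t%:E)%E /\ rho T t = t.

Definition left_scattered (R : realType) (T : set R) (t : R) : Prop :=
  rho T t < t.

Definition ts_itv (R : realType) (T : set R) (a b : R) : set R :=
  [set t | T t /\ a <= t <= b].

(* T^kappa: T without its maximum when that maximum is left-scattered. *)
Definition kappa (R : realType) (T : set R) : set R :=
  [set t | T t /\ ~ (ubound T t /\ left_scattered T t)].

Definition is_delta_deriv (R : realType) (T : set R) (u : R -> R) (t d : R)
    : Prop :=
  forall e : R, 0 < e -> \forall r \near within T (nbhs t),
    `|u (sigma T t) - u r - d * (sigma T t - r)| <= e * `|sigma T t - r|.

Definition delta_derivable (R : realType) (T : set R) (u : R -> R) (t : R)
    : Prop :=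
  exists d, is_delta_deriv T u t d.

(* Meaningful for t in T^kappa with u delta differentiable at t, where the
   derivative is unique; 0 if there is no derivative. *)
Definition delta_deriv (R : realType) (T : set R) (u : R -> R) (t : R) : R :=
  xget 0 [set d | is_delta_deriv T u t d].

Definition pdelta1 (R : realType) (T : set R) (f : R -> R -> R -> R) :=
  fun x y z : R => delta_deriv T (fun r => f r y z) x.

Definition pdelta2 (R : realType) (T : set R) (f : R -> R -> R -> R) :=
  fun x y z : R => delta_deriv T (fun r => f x r z) y.

Definition pdelta3 (R : realType) (T : set R) (f : R -> R -> R -> R) :=
  fun x y z : R => delta_deriv T (fun r => f x y r) z.

Definition mixed_delta (R : realType) (X1 X2 X3 : set R)
    (f : R -> R -> R -> R) : R -> R -> R -> R :=
  pdelta3 X3 (pdelta2 X2 (pdelta1 X1 f)).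

(* Each variable ranges over X_i until one has differentiated in it, and over
   X_i^kappa from then on. *)
Definition mixed_delta_exists (R : realType) (X1 X2 X3 : set R)
    (f : R -> R -> R -> R) : Prop :=
  [/\ forall x y z, kappa X1 x -> X2 y -> X3 z ->
        delta_derivable X1 (fun r => f r y z) x,
      forall x y z, kappa X1 x -> kappa X2 y -> X3 z ->
        delta_derivable X2 (fun r => pdelta1 X1 f x r z) y
    & forall x y z, kappa X1 x -> kappa X2 y -> kappa X3 z ->
        delta_derivable X3 (fun r => pdelta2 X2 (pdelta1 X1 f) x y r) z].

Definition on_side (R : realType) (l : bool) (p q : R) : Prop :=
  if l then q < p else p <= q.

(* Rd-continuity on the product of the time scales X1, X2, X3. The set L of
   coordinates approached strictly from the left is given by its indicator
   (l1, l2, l3). *)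
Definition rd_continuous3 (R : realType) (X1 X2 X3 : set R)
    (f : R -> R -> R -> R) : Prop :=
  forall (p1 p2 p3 : R) (l1 l2 l3 : bool),
  X1 p1 -> X2 p2 -> X3 p3 ->
  (l1 -> left_dense X1 p1) -> (l2 -> left_dense X2 p2) ->
  (l3 -> left_dense X3 p3) ->
  exists v : R,
    (fun q : R * R * R => f q.1.1 q.1.2 q.2) @
      within [set q : R * R * R |
          [/\ X1 q.1.1, X2 q.1.2 & X3 q.2] /\
          [/\ on_side l1 p1 q.1.1, on_side l2 p2 q.1.2 & on_side l3 p3 q.2]]
        (nbhs (p1, p2, p3)) --> v
    /\ ((l1 -> right_dense X1 p1) -> (l2 -> right_dense X2 p2) ->
        (l3 -> right_dense X3 p3) -> v = f p1 p2 p3).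

Definition bounded_on3 (R : realType) (X1 X2 X3 : set R)
    (f : R -> R -> R -> R) : Prop :=
  exists M : R, forall x y z, X1 x -> X2 y -> X3 z -> `|f x y z| <= M.

(* Supremum of |f| on X1 * X2 * X3; meaningful when f is bounded there. *)
Definition sup_norm3 (R : realType) (X1 X2 X3 : set R)
    (f : R -> R -> R -> R) : R :=
  sup [set `|f q.1.1 q.1.2 q.2| | q in X1 `*` X2 `*` X3].

(* F^Delta = u is required on [a, b) only, with F continuous on [a, b]: an
   rd-continuous u may jump at a left-dense b, in which case no F satisfies
   F^Delta b = u b, but the integral does not depend on u b. *)
Definition delta_antideriv (R : realType) (T : set R) (a b : R)
    (u F : R -> R) : Prop :=
  {within ts_itv T a b, continuous F} /\
  forall t, T t -> a <= t < b -> is_delta_deriv (ts_itv T a b) F t (u t).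

(* Cauchy delta integral, for a <= b in T; 0 if u has no antiderivative. *)
Definition delta_integral (R : realType) (T : set R) (a b : R) (u : R -> R)
    : R :=
  xget 0 [set I | exists2 F, delta_antideriv T a b u F & I = F b - F a].

(* The operator A of the inequality on the box [c1, d1] * [c2, d2] * [c3, d3]. *)
Definition opA (R : realType) (c1 d1 c2 d2 c3 d3 : R) (h : R -> R -> R -> R)
    (x y z : R) : R :=
  8^-1 * (h c1 c2 c3 + h d1 d2 d3 + h c1 c2 d3 + h c1 d2 c3
          + h d1 c2 c3 + h c1 d2 d3 + h d1 d2 c3 + h d1 c2 d3)
  - 4^-1 * (h x c2 c3 + h x d2 d3 + h x d2 c3 + h x c2 d3)
  - 4^-1 * (h c1 y c3 + h d1 y d3 + h c1 y d3 + h d1 y c3)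
  - 4^-1 * (h c1 c2 z + h d1 d2 z + h d1 c2 z + h c1 d2 z)
  + 2^-1 * (h c1 y z + h d1 y z) + 2^-1 * (h x c2 z + h x d2 z)
  + 2^-1 * (h x y c3 + h x y d3).

(* Main.v *)
Require Import Defs.
From HB Require Import structures.
From mathcomp Require Import all_boot all_order all_algebra.
From mathcomp Require Import all_classical all_reals all_analysis.
From mathcomp Require Import lra ring.
Set Implicit Arguments.
Unset Strict Implicit.
Unset Printing Implicit Defensive.
Import Order.TTheory GRing.Theory Num.Theory.
Import numFieldNormedType.Exports.
Local Open Scope classical_set_scope.
Local Open Scope ring_scope.

(** Write [A h] for the combination [opA] of the vertex, edge and face values
    of [h]. At a point [(x, y, z)] of the box
    [[c1, b1] * [c2, b2] * [c3, b3]], the difference [h - A h] is one eighth of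
    the sum, over the eight vertices [u] of the box, of the alternating sum of
    [h] over the vertices of the small box spanned by [(x, y, z)] and [u]. Three
    applications of the mean value inequality on time scales
    ([delta_lipschitz]) bound each alternating sum by the volume of the small
    box times the supremum [M] of the mixed derivative
    ([mixed_difference_le]). The eight small boxes tile the box, so
    [|h - A h| <= V * M / 8] with [V] its volume ([opA_error_le]). Since
    [f g - (f A g + g A f) / 2 = (f (g - A g) + g (f - A f)) / 2], the integrand
    on the left is at most [V / 16] times the integrand on the right.

    It remains to integrate this inequality. The integral of a function without
    antiderivative is 0, and the integrand on the right is nonnegative, so only
    the antiderivatives on the right are needed, at each of the three levels of
    the iterated integral ([delta_integral_le]).
    - An rd-continuous function of one variable on a compact interval has an
      antiderivative ([rd_delta_integrable]). It is bounded by compactness,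
      and its antiderivative is the largest function vanishing at the left
      endpoint whose growth on each interval is at most the supremum of the
      integrand times the length ([darboux_primitive]), a variant of the
      Darboux integral without partitions.
    - The integral over one variable of a jointly rd-continuous function is
      rd-continuous in the remaining ones ([rd_delta_integral]): by compactness
      the one-sided limits in the parameters are uniform in the variable of
      integration. To treat two parameters and one parameter at once, this is
      proved for an abstract family of one-sided filters ([sided_space]). *)

(** * Jump operators and neighbourhoods in a closed set *)

Lemma near_withinP (R : realType) (X : set R) (t : R) (P : R -> Prop) :
  (\forall r \near within X (nbhs t), P r) <->
  exists2 d, 0 < d & forall r, X r -> `|r - t| < d -> P r.
Proof.
rewrite near_withinE; split.
  move=> /nbhs_ballP[d /= d0 dP]; exists d => // r Xr rt.
  by apply: dP => //; rewrite /ball/= distrC.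
move=> [d d0 dP]; apply/nbhs_ballP; exists d => //= r.
by rewrite /ball/= distrC => rt Xr; exact: dP.
Qed.

Lemma closed_adherent (R : realType) (X : set R) (m : R) : closed X ->
  (forall d, 0 < d -> exists2 r, X r & `|r - m| < d) -> X m.
Proof.
move=> Xc H; apply: Xc => B /nbhs_ballP[d /= d0 dB].
have [r Xr rm] := H _ d0; exists r; split => //.
by apply: dB; rewrite /ball/= distrC.
Qed.

Lemma sigma_none (R : realType) (X : set R) (t : R) :
  ~ (exists2 r, X r & t < r) -> sigma X t = t.
Proof. by move=> H; rewrite /sigma asboolF. Qed.

Lemma rho_none (R : realType) (X : set R) (t : R) :
  ~ (exists2 r, X r & r < t) -> rho X t = t.
Proof. by move=> H; rewrite /rho asboolF. Qed.

Lemma sigma_infP (R : realType) (X : set R) (t : R) :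
  (exists2 r, X r & t < r) -> has_inf [set r | X r /\ t < r] /\
  sigma X t = inf [set r | X r /\ t < r].
Proof.
move=> H; split; last by rewrite /sigma asboolT.
by case: H => r Xr tr; split; [exists r|exists t => x /= [_ /ltW]].
Qed.

Lemma rho_supP (R : realType) (X : set R) (t : R) :
  (exists2 r, X r & r < t) -> has_sup [set r | X r /\ r < t] /\
  rho X t = sup [set r | X r /\ r < t].
Proof.
move=> H; split; last by rewrite /rho asboolT.
by case: H => r Xr tr; split; [exists r|exists t => x /= [_ /ltW]].
Qed.

Lemma sigma_le (R : realType) (X : set R) (t r : R) :
  X r -> t < r -> sigma X t <= r.
Proof.
move=> Xr tr; have [[_ lb] ->] := @sigma_infP _ X t (ex_intro2 _ _ r Xr tr).
exact: ge_inf.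
Qed.

Lemma le_sigma (R : realType) (X : set R) (t : R) : t <= sigma X t.
Proof.
have [H|H] := pselect (exists2 r, X r & t < r); last by rewrite sigma_none.
have [[ne _] ->] := sigma_infP H.
by apply: lb_le_inf => // x /= [_ /ltW].
Qed.

Lemma le_rho (R : realType) (X : set R) (t r : R) :
  X r -> r < t -> r <= rho X t.
Proof.
move=> Xr tr; have [[_ lb] ->] := @rho_supP _ X t (ex_intro2 _ _ r Xr tr).
exact: ub_le_sup.
Qed.

Lemma rho_le (R : realType) (X : set R) (t : R) : rho X t <= t.
Proof.
have [H|H] := pselect (exists2 r, X r & r < t); last by rewrite rho_none.
have [[ne _] ->] := rho_supP H.
by apply: ge_sup => // x /= [_ /ltW].
Qed.

Lemma sigma_in (R : realType) (X : set R) (t : R) : closed X -> X t ->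
  X (sigma X t).
Proof.
move=> Xc Xt.
have [H|H] := pselect (exists2 r, X r & t < r); last by rewrite sigma_none.
have [hi e] := sigma_infP H.
apply: closed_adherent => // d d0.
have [r [Xr tr] rd] := inf_adherent d0 hi.
exists r => //; rewrite ger0_norm ?subr_ge0 ?sigma_le// e; lra.
Qed.

Lemma rho_in (R : realType) (X : set R) (t : R) : closed X -> X t ->
  X (rho X t).
Proof.
move=> Xc Xt.
have [H|H] := pselect (exists2 r, X r & r < t); last by rewrite rho_none.
have [hi e] := rho_supP H.
apply: closed_adherent => // d d0.
have [r [Xr tr] rd] := sup_adherent d0 hi.
exists r => //; rewrite distrC ger0_norm ?subr_ge0 ?le_rho// e; lra.
Qed.

Lemma sigma_eq_adherent (R : realType) (X : set R) (t d : R) :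
  sigma X t = t -> (exists2 r, X r & t < r) -> 0 < d ->
  exists2 r, X r & t < r < t + d.
Proof.
move=> st H d0; have [hi e] := sigma_infP H.
have [r [Xr tr] rd] := inf_adherent d0 hi.
by exists r => //; rewrite tr/= -{1}st e.
Qed.

Lemma rho_eq_adherent (R : realType) (X : set R) (t d : R) :
  rho X t = t -> (exists2 r, X r & r < t) -> 0 < d ->
  exists2 r, X r & t - d < r < t.
Proof.
move=> st H d0; have [hi e] := rho_supP H.
have [r [Xr tr] rd] := sup_adherent d0 hi.
by exists r => //; rewrite tr/= -{1}st e andbT.
Qed.

(** A left-scattered point is reached from its predecessor in one jump: this
    is how left-scattered points are handled in the mean value inequality. *)
Lemma sigma_rho (R : realType) (X : set R) (t : R) : closed X -> X t ->
  rho X t < t -> sigma X (rho X t) = t.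
Proof.
move=> Xc Xt rt; apply/eqP; rewrite eq_le sigma_le//=.
rewrite leNgt; apply/negP => st.
have := le_rho (sigma_in Xc (rho_in Xc Xt)) st.
move=> le_sr; have e : sigma X (rho X t) = rho X t.
  by apply/eqP; rewrite eq_le le_sr le_sigma.
have [||r Xr /andP[r1 r2]] := @sigma_eq_adherent _ X (rho X t) (t - rho X t) e.
- by exists t.
- by rewrite subr_gt0.
by have := @le_rho _ X t r Xr; lra.
Qed.

(** * Delta derivatives *)

Lemma is_delta_derivP (R : realType) (X : set R) (u : R -> R) (t d : R) :
  is_delta_deriv X u t d <-> forall e, 0 < e -> exists2 eta, 0 < eta &
    forall r, X r -> `|r - t| < eta ->
      `|u (sigma X t) - u r - d * (sigma X t - r)| <= e * `|sigma X t - r|.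
Proof.
by split=> H e e0; [exact/near_withinP/H|apply/near_withinP/H].
Qed.

Lemma is_delta_derivD (R : realType) (X : set R) (u v : R -> R) (t d e : R) :
  is_delta_deriv X u t d -> is_delta_deriv X v t e ->
  is_delta_deriv X (fun r => u r + v r) t (d + e).
Proof.
move=> /is_delta_derivP du /is_delta_derivP dv; apply/is_delta_derivP => k k0.
have k20 : 0 < k / 2 by lra.
have [a a0 ua] := du _ k20; have [b b0 vb] := dv _ k20.
exists (Num.min a b); first by rewrite lt_min a0.
move=> r Xr; rewrite lt_min => /andP[ra rb].
have {}ua := ua r Xr ra; have {}vb := vb r Xr rb.
apply: (le_trans _
  (_ : k / 2 * `|sigma X t - r| + k / 2 * `|sigma X t - r| <= _)).
  2: by rewrite -mulrDl -splitr.
apply: le_trans (lerD ua vb); apply: le_trans (ler_normD _ _).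
by rewrite le_eqVlt; apply/orP; left; apply/eqP; congr `|_|; ring.
Qed.

Lemma is_delta_derivZ (R : realType) (X : set R) (u : R -> R) (t d c : R) :
  is_delta_deriv X u t d -> is_delta_deriv X (fun r => c * u r) t (c * d).
Proof.
move=> /is_delta_derivP du; apply/is_delta_derivP => k k0.
have k1 : 0 < k / (`|c| + 1) by rewrite divr_gt0// ltr_wpDl.
have [a a0 ua] := du _ k1; exists a => // r Xr ra.
have {}ua := ua r Xr ra.
rewrite (_ : _ - _ = c * (u (sigma X t) - u r - d * (sigma X t - r))).
  2: by ring.
rewrite normrM; apply: le_trans (ler_wpM2l (normr_ge0 _) ua) _.
rewrite mulrA ler_wpM2r// mulrCA ger_pMr//.
by rewrite ler_pdivrMr ?mul1r ?lerDl ?ltr_wpDl.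
Qed.

Lemma is_delta_derivB (R : realType) (X : set R) (u v : R -> R) (t d e : R) :
  is_delta_deriv X u t d -> is_delta_deriv X v t e ->
  is_delta_deriv X (fun r => u r - v r) t (d - e).
Proof.
move=> du dv.
have := is_delta_derivD du (is_delta_derivZ (-1) dv).
rewrite mulN1r; congr is_delta_deriv; apply/funext => r.
by rewrite mulN1r.
Qed.

(** Continuity at a point in epsilon-delta form, so that it can be combined
    with explicit difference quotients by linear arithmetic. *)
Definition cont_at (R : realType) (X : set R) (u : R -> R) (t : R) :=
  forall e, 0 < e -> exists2 d, 0 < d &
    forall r, X r -> `|r - t| < d -> `|u r - u t| <= e.

Lemma cont_atP (R : realType) (X : set R) (u : R -> R) (t : R) :
  cont_at X u t <-> u r @[r --> within X (nbhs t)] --> u t.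
Proof.
split => [H|/cvgrPdist_le H e e0].
- apply/cvgrPdist_le => e e0; apply/near_withinP.
  have [d d0 dP] := H e e0.
  by exists d => // r Xr rt; rewrite distrC; exact: dP.
- have /near_withinP[d d0 dP] := H _ e0.
  by exists d => // r Xr rt; rewrite distrC; exact: dP.
Qed.

Lemma within_cont_at (R : realType) (X : set R) (u : R -> R) :
  {within X, continuous u} <-> forall t, X t -> cont_at X u t.
Proof.
by rewrite subspace_continuousP; split => H t Xt; apply/cont_atP; exact: H.
Qed.

(** Comparing the defining inequality at [r] with the one at [t] itself
    eliminates [u (sigma X t)] and leaves [u r - u t]; this also works at a
    right-scattered [t], where [sigma X t - t] does not tend to 0. *)
Lemma delta_deriv_cont (R : realType) (X : set R) (u : R -> R) (t d : R) :
  X t -> is_delta_deriv X u t d -> cont_at X u t.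
Proof.
move=> Xt /is_delta_derivP du e e0.
(* With slack k in both inequalities the error at r is at most
   k * (2 * m + 1 + |d|) as soon as |r - t| < min(1, k). *)
set m := sigma X t - t; have m0 : 0 <= m by rewrite subr_ge0 le_sigma.
have k0 : 0 < e / (2 * m + 2 + `|d|) / 2.
  by rewrite divr_gt0// divr_gt0// ltr_wpDr// ltr_wpDl// mulr_ge0.
have D0 : 0 < 2 * m + 2 + `|d| by rewrite ltr_wpDr// ltr_wpDl// mulr_ge0.
set k := e / (2 * m + 2 + `|d|) / 2 in k0.
have mk0 : 0 < Num.min k 1 by rewrite lt_min k0 ltr01.
have [a a0 ua] := du _ mk0.
exists (Num.min a (Num.min 1 k)); first by rewrite !lt_min a0 ltr01.
move=> r Xr; rewrite !lt_min => /and3P[ra r1 rk].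
have {}ua1 := ua r Xr ra.
have := ua t Xt; rewrite subrr normr0 => /(_ a0) ua2.
rewrite -/m in ua2.
have e1 : `|sigma X t - r| <= m + `|r - t|.
  rewrite (_ : sigma X t - r = m - (r - t)); last by rewrite /m; ring.
  by apply: le_trans (ler_normB _ _) _; rewrite ger0_norm.
rewrite (ger0_norm m0) in ua2.
have -> : u r - u t = (u (sigma X t) - u t - d * m) -
   (u (sigma X t) - u r - d * (sigma X t - r)) + d * (r - t).
  by rewrite /m; ring.
have kmin : Num.min k 1 <= k by rewrite ge_min lexx.
have ke : k * (2 * m + 2 + `|d|) * 2 = e by rewrite /k; field; rewrite gt_eqF.
have ? : `|d * (r - t)| <= `|d| * k by rewrite normrM ler_wpM2l// ltW.
have ? : Num.min k 1 * m <= k * m by rewrite ler_wpM2r.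
have ? : Num.min k 1 * `|sigma X t - r| <= k * (m + 1).
  apply: (le_trans (ler_wpM2r (normr_ge0 _) kmin)).
  by rewrite ler_wpM2l ?(ltW k0)//; lra.
have ? : 0 <= `|d| * k by rewrite mulr_ge0 // ltW.
have ? : 0 <= k * m by rewrite mulr_ge0 // ltW.
have := ler_normD (u (sigma X t) - u t - d * m -
   (u (sigma X t) - u r - d * (sigma X t - r))) (d * (r - t)).
have := ler_normB (u (sigma X t) - u t - d * m)
   (u (sigma X t) - u r - d * (sigma X t - r)).
lra.
Qed.

Lemma cont_atB (R : realType) (X : set R) (u v : R -> R) (t : R) :
  cont_at X u t -> cont_at X v t -> cont_at X (fun r => u r - v r) t.
Proof. by move=> /cont_atP cu /cont_atP cv; apply/cont_atP; exact: cvgB. Qed.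

Lemma cont_atZ (R : realType) (X : set R) (u : R -> R) (c t : R) :
  cont_at X u t -> cont_at X (fun r => c * u r) t.
Proof. by move=> /cont_atP cu; apply/cont_atP; exact: cvgMr. Qed.

(** * Mean value inequalities *)

(** One-sided mean value inequality. For [e > 0] let [m] be the infimum of the
    points [r] at which [w r - w s <= (k + e) * (r - s)] fails. If the bound
    holds at [m], then [m] is right-dense and the derivative at [m] propagates
    the bound to the right of [m]. If it fails at [m], then it holds just to
    the left of [m]: continuity (left-dense [m]) or the derivative at the
    predecessor (left-scattered [m]) carries it over to [m]. *)
Lemma delta_growth_le (R : realType) (X : set R) (w : R -> R) (k s t : R) :
  closed X -> X s -> X t -> s <= t ->
  (forall r, X r -> s <= r <= t -> cont_at X w r) ->
  (forall r, X r -> s <= r < t -> exists2 d, d <= k & is_delta_deriv X w r d) ->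
  w t - w s <= k * (t - s).
Proof.
move=> Xc Xs Xt st wc wd.
have D0 : 0 < t - s + 1 by lra.
apply/ler_addgt0Pr => e0 e00; set e := e0 / (t - s + 1).
have e_gt0 : 0 < e by rewrite divr_gt0.
have ee : e * (t - s) <= e0.
  have : e * (t - s + 1) = e0 by rewrite /e; field; rewrite gt_eqF.
  by lra.
apply: (@le_trans _ _ ((k + e) * (t - s))); last by lra.
set K := k + e; rewrite leNgt; apply/negP => nPt.
pose E := [set r | [/\ X r, s <= r <= t & K * (r - s) < w r - w s]].
have E0 : E t by split => //; rewrite st lexx.
have hE : has_inf E.
  by split; [exists t|exists s => r /= [_ /andP[]]].
set m := inf E.
have mt : m <= t by apply: ge_inf => //; case: hE.
have sm : s <= m by apply: lb_le_inf; [exists t|move=> r /= [_ /andP[]]].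
have Xm : X m.
  apply: closed_adherent => // d d0; have [r Er rd] := inf_adherent d0 hE.
  have mr : m <= r by apply: ge_inf => //; case: hE.
  by exists r; [case: Er|rewrite ger0_norm ?subr_ge0//; rewrite -/m in rd; lra].
have below r : X r -> s <= r < m -> w r - w s <= K * (r - s).
  move=> Xr /andP[sr rm]; rewrite leNgt; apply/negP => nP.
  suff : m <= r by rewrite leNgt rm.
  by apply: ge_inf; [case: hE|split => //; rewrite sr (le_trans (ltW rm))].
have [Pm|nPm] := leP (w m - w s) (K * (m - s)).
- (* The bound holds at m, so the failures accumulate at m from the right. *)
  have mt' : m < t.
    rewrite lt_neqAle mt andbT; apply/negP => /eqP e'.
    by move: Pm; rewrite e'; lra.
  have near_E d : 0 < d -> exists2 r, E r & m < r < m + d.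
    move=> d0; have [r Er rd] := inf_adherent d0 hE.
    exists r => //; rewrite rd andbT lt_neqAle; apply/andP; split.
      by apply/negP => /eqP mr; case: Er => _ _; rewrite -mr; lra.
    by apply: ge_inf => //; case: hE.
  have sm' : sigma X m = m.
    apply/eqP; rewrite eq_le le_sigma andbT leNgt; apply/negP => ms.
    have [|r [Xr _ _] /andP[mr rm]] := near_E (sigma X m - m).
      by rewrite subr_gt0.
    by have := sigma_le Xr mr; lra.
  have [|d dk /is_delta_derivP/(_ _ e_gt0)[eta eta0 H]] := wd _ Xm.
    by rewrite sm.
  have [r [Xr _ nPr] /andP[mr rm]] := near_E _ eta0.
  have := H r Xr; rewrite gtr0_norm ?subr_gt0//.
  rewrite sm' (distrC m r) (gtr0_norm (_ : 0 < r - m)) ?subr_gt0//.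
  have -> : r - m < eta by lra.
  move=> /(_ isT) /ler_normlP[+ _].
  have : d * (r - m) <= k * (r - m) by rewrite ler_wpM2r// subr_ge0 ltW.
  rewrite /K in Pm nPr *; lra.
- (* The bound fails at m. *)
  have sm' : s < m.
    rewrite lt_neqAle sm andbT; apply/negP => /eqP e'.
    by move: nPm; rewrite -e'; lra.
  have [rm|mr] := ltP (rho X m) m.
  + have Xr := rho_in Xc Xm.
    have sr : s <= rho X m by exact: le_rho.
    have [|d dk /is_delta_derivP/(_ _ e_gt0)[eta eta0 H]] := wd _ Xr.
      by rewrite sr (lt_le_trans rm).
    have := H _ Xr; rewrite subrr normr0 => /(_ eta0).
    rewrite sigma_rho// (gtr0_norm (_ : 0 < m - rho X m)) ?subr_gt0//.
    move=> /ler_normlP[_].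
    have : d * (m - rho X m) <= k * (m - rho X m).
      by rewrite ler_wpM2r// subr_ge0 ltW.
    have := below _ Xr; rewrite sr rm => /(_ isT).
    rewrite /K in nPm *; lra.
  + have rE : rho X m = m by apply/eqP; rewrite eq_le rho_le.
    set dl := w m - w s - K * (m - s).
    have dl0 : 0 < dl by rewrite /dl subr_gt0.
    have dl20 : 0 < dl / 2 by rewrite divr_gt0.
    have smt : s <= m <= t by rewrite sm mt.
    have [d d0 H] := wc _ Xm smt _ dl20.
    have q0 : 0 < dl / 2 / (`|K| + 1) by apply: divr_gt0 => //; apply: ltr_wpDl.
    have [||r Xr /andP[mr' rm]] := @rho_eq_adherent _ X m
      (Num.min d (Num.min (m - s) (dl / 2 / (`|K| + 1)))) rE.
    * by exists s.
    * by rewrite !lt_min d0 subr_gt0 sm'.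
    have : m - r < Num.min d (Num.min (m - s) (dl / 2 / (`|K| + 1))) by lra.
    rewrite !lt_min => /and3P[rd rs rq].
    have := H r Xr; rewrite distrC gtr0_norm ?subr_gt0//.
    move=> /(_ rd) /ler_normlP[+ _].
    have srm : s <= r < m by apply/andP; split => //; lra.
    have := below r Xr srm.
    have : - K * (m - r) < dl / 2.
      apply: le_lt_trans (ler_norm _) _.
      rewrite normrM normrN (gtr0_norm (_ : 0 < m - r)) ?subr_gt0//.
      move: rq; rewrite ltr_pdivlMr ?ltr_wpDl// => rq.
      have : 0 <= m - r by lra.
      by lra.
    by rewrite /dl; lra.
Qed.

(** The maximum of [X], if it exists, is either in [kappa X], hence a point of
    continuity, or left-scattered, hence isolated from the left. *)
Lemma delta_lipschitz (R : realType) (X : set R) (w : R -> R) (k s t : R) :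
  closed X -> X s -> X t ->
  (forall r, kappa X r -> exists2 d, `|d| <= k & is_delta_deriv X w r d) ->
  `|w t - w s| <= k * `|t - s|.
Proof.
move=> Xc; wlog st : s t / s <= t.
  move=> H Xs Xt wd; have [/H|/ltW/H] := leP s t; first exact.
  by rewrite distrC (distrC t); exact.
move=> Xs Xt wd.
have wc r : X r -> cont_at X w r.
  move=> Xr; have [kr|nkr] := pselect (kappa X r).
    by have [d _] := wd _ kr; exact: delta_deriv_cont.
  have [ur lr] : ubound X r /\ left_scattered X r.
    by apply: contrapT => H; apply: nkr.
  move=> e e0; exists (r - rho X r) => [|q Xq qr]; first by rewrite subr_gt0.
  suff -> : q = r by rewrite subrr normr0 ltW.
  apply/eqP; rewrite eq_le ur//= leNgt; apply/negP => qr'.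
  have := le_rho Xq qr'; move: qr; rewrite distrC gtr0_norm ?subr_gt0//; lra.
have wk r : X r -> s <= r < t -> kappa X r.
  by move=> Xr /andP[_ rt]; split => // -[/(_ _ Xt)]; rewrite leNgt rt.
rewrite (ger0_norm (_ : 0 <= t - s)) ?subr_ge0//; apply/ler_normlP; split.
- rewrite [leLHS](_ : _ = -1 * w t - -1 * w s); last by ring.
  apply: (@delta_growth_le _ X (fun r => -1 * w r)) => //.
    by move=> r Xr _; apply: cont_atZ; exact: wc.
  move=> r Xr /(wk _ Xr)/wd[d dk dw]; exists (-1 * d).
    by rewrite mulN1r; case/ler_normlP: dk.
  exact: is_delta_derivZ.
- apply: (@delta_growth_le _ X w) => //.
    by move=> r Xr _; exact: wc.
  move=> r Xr /(wk _ Xr)/wd[d dk dw]; exists d => //.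
  by case/ler_normlP: dk.
Qed.

(** * Comparison of delta integrals *)

Lemma ts_itv_closed (R : realType) (T : set R) (a b : R) :
  closed T -> closed (ts_itv T a b).
Proof.
move=> Tc; rewrite (_ : ts_itv T a b = T `&` `[a, b]%classic).
  by apply: closedI => //; exact: interval_closed.
by rewrite set_itvE.
Qed.

Lemma ts_itv_sub (R : realType) (T : set R) (a b c r : R) :
  a <= c -> ts_itv T c b r -> ts_itv T a b r.
Proof.
by move=> ac [Tr /andP[cr rb]]; split => //; rewrite rb (le_trans ac).
Qed.

Lemma ts_itv_compact (R : realType) (T : set R) (a b : R) :
  closed T -> compact (ts_itv T a b).
Proof.
move=> Tc; apply: (subclosed_compact _ (@segment_compact _ a b)).
  exact: ts_itv_closed.
by rewrite set_itvE => r [].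
Qed.

(** This one estimate gives monotonicity and homogeneity of the integral
    ([k = 0]), its continuity under uniform perturbations of the integrand
    ([C = 1]), and the independence of the choice of an antiderivative. *)
Lemma antideriv_growth_le (R : realType) (T : set R) (a b C k : R)
    (u v F G : R -> R) :
  closed T -> T a -> T b -> a <= b ->
  delta_antideriv T a b u F -> delta_antideriv T a b v G ->
  (forall t, ts_itv T a b t -> u t <= C * v t + k) ->
  F b - F a <= C * (G b - G a) + k * (b - a).
Proof.
move=> Tc Ta Tb ab [/within_cont_at Fc Fd] [/within_cont_at Gc Gd] uv.
have Xc := @ts_itv_closed _ T a b Tc.
have Xa : ts_itv T a b a by split => //; rewrite lexx ab.
have Xb : ts_itv T a b b by split => //; rewrite lexx ab.
suff : F b - C * G b - (F a - C * G a) <= k * (b - a) by lra.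
apply: (@delta_growth_le _ (ts_itv T a b) (fun r => F r - C * G r)) => //.
  by move=> r Xr _; apply: cont_atB; [exact: Fc|apply: cont_atZ; exact: Gc].
move=> r Xr rab; have := uv _ Xr => ur; exists (u r - C * v r); first lra.
case: Xr => Tr _; apply: is_delta_derivB; first exact: Fd.
by apply: is_delta_derivZ; exact: Gd.
Qed.

Definition delta_integrable (R : realType) (T : set R) (a b : R) (u : R -> R) :=
  exists F, delta_antideriv T a b u F.

Lemma delta_integralP (R : realType) (T : set R) (a b : R) (u : R -> R) :
  delta_integrable T a b u ->
  exists2 F, delta_antideriv T a b u F & delta_integral T a b u = F b - F a.
Proof.
move=> [F Fu]; rewrite /delta_integral.
apply: (@xgetPex _ 0
  [set I | exists2 F, delta_antideriv T a b u F & I = F b - F a]).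
by exists (F b - F a); exists F.
Qed.

Lemma delta_integral_none (R : realType) (T : set R) (a b : R) (u : R -> R) :
  ~ delta_integrable T a b u -> delta_integral T a b u = 0.
Proof.
move=> nu; rewrite /delta_integral; case: xgetP => // I _ [F Fu _].
by case: nu; exists F.
Qed.

Lemma delta_integral_growth_le (R : realType) (T : set R) (a b C k : R)
    (u v : R -> R) :
  closed T -> T a -> T b -> a <= b ->
  delta_integrable T a b u -> delta_integrable T a b v ->
  (forall t, ts_itv T a b t -> u t <= C * v t + k) ->
  delta_integral T a b u <= C * delta_integral T a b v + k * (b - a).
Proof.
move=> Tc Ta Tb ab /delta_integralP[F Fu ->] /delta_integralP[G Gv ->].
exact: antideriv_growth_le Fu Gv.
Qed.

Lemma delta_antideriv0 (R : realType) (T : set R) (a b : R) :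
  delta_antideriv T a b (fun=> 0) (fun=> 0).
Proof.
split; first by move=> x; exact: cvg_cst.
move=> t Tt _; apply/is_delta_derivP => e e0; exists 1 => // r _ _.
by rewrite subrr mul0r subr0 normr0 mulr_ge0// ltW.
Qed.

Lemma delta_integral_ge0 (R : realType) (T : set R) (a b : R) (u : R -> R) :
  closed T -> T a -> T b -> a <= b ->
  (forall t, ts_itv T a b t -> 0 <= u t) -> 0 <= delta_integral T a b u.
Proof.
move=> Tc Ta Tb ab u0.
have [/delta_integralP[F Fu ->]|/delta_integral_none->//] :=
  pselect (delta_integrable T a b u).
have := antideriv_growth_le (C := 1) (k := 0) Tc Ta Tb ab
  (delta_antideriv0 T a b) Fu.
rewrite subrr mul1r mul0r addr0; apply => t Xt.
by rewrite mul1r addr0 u0.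
Qed.

(** If [u] has no antiderivative, then its integral is 0, which is below the
    right-hand side because [v >= 0]. *)
Lemma delta_integral_le (R : realType) (T : set R) (a b C : R) (u v : R -> R) :
  closed T -> T a -> T b -> a <= b -> 0 <= C ->
  (forall t, ts_itv T a b t -> 0 <= v t) -> delta_integrable T a b v ->
  (forall t, ts_itv T a b t -> u t <= C * v t) ->
  delta_integral T a b u <= C * delta_integral T a b v.
Proof.
move=> Tc Ta Tb ab C0 v0 vi uv.
have [ui|/delta_integral_none->] := pselect (delta_integrable T a b u);
  last first.
  by rewrite mulr_ge0// delta_integral_ge0.
have := @delta_integral_growth_le _ T a b C 0 u v Tc Ta Tb ab ui vi.
rewrite mul0r addr0; apply => t Xt; rewrite addr0; exact: uv.
Qed.

(** * Existence of delta antiderivatives *)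

(** The functions [G] with [G c = 0] that grow on every [[p, q]] up to [t] at
    most like the supremum of [u] on [[p, q)] (quantified as an upper bound
    [k]). This class is stable under gluing two functions at a point, which is
    what replaces the refinement of partitions in a Darboux integral. *)
Definition sub_primitive (R : realType) (X : set R) (c : R) (u : R -> R) (t : R)
    (G : R -> R) : Prop :=
  G c = 0 /\ forall p q k, X p -> X q -> p <= q <= t ->
    (forall r, X r -> p <= r < q -> u r <= k) -> G q - G p <= k * (q - p).

(** [F t] is the supremum of [G t] over the sub-primitives up to [t]. The upper
    growth estimate passes to the supremum; for the lower one, a sub-primitive
    up to [s] is continued affinely on [[s, t]] with slope [k], a lower bound
    of [u] there, and remains a sub-primitive. *)
Lemma darboux_primitive (R : realType) (X : set R) (c K : R) (u : R -> R) :
  X c -> (forall r, X r -> c <= r) -> (forall r, X r -> `|u r| <= K) ->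
  exists F : R -> R, forall s t k, X s -> X t -> s <= t ->
    ((forall r, X r -> s <= r < t -> u r <= k) -> F t - F s <= k * (t - s)) /\
    ((forall r, X r -> s <= r < t -> k <= u r) -> k * (t - s) <= F t - F s).
Proof.
move=> Xc cX uK.
pose E t := [set x | exists2 G, sub_primitive X c u t G & x = G t].
have E0 t : E t !=set0.
  (* The slope -K is below every value of u. *)
  exists (- K * (t - c)); exists (fun r => - K * (r - c)) => //; split.
    by rewrite subrr mulr0.
  move=> p q k Xp Xq /andP[pq qt] uk.
  have [->|qp] := eqVneq p q; first by rewrite !subrr mulr0.
  have {}pq : p < q by rewrite lt_neqAle qp.
  have kK : - K <= k.
    apply: le_trans (uk p Xp _); last by rewrite lexx.
    by have /ler_normlP[] := uK p Xp; lra.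
  rewrite -mulrBr (_ : q - c - (p - c) = q - p); last by ring.
  by rewrite ler_wpM2r// subr_ge0 ltW.
have Eub t : X t -> ubound (E t) (K * (t - c)).
  move=> Xt x [G [Gc GP] ->]; have ct := cX _ Xt.
  have := GP c t K Xc Xt; rewrite Gc ct lexx subr0; apply=> // r Xr _.
  by have /ler_normlP[] := uK r Xr.
have sup_ge t x : X t -> E t x -> x <= sup (E t).
  by move=> Xt; apply: ub_le_sup; exists (K * (t - c)); exact: Eub.
exists (fun t => sup (E t)) => s t k Xs Xt st; split => uk.
- rewrite lerBlDr; apply: ge_sup => // x [G [Gc GP] ->].
  have Gs : G s <= sup (E s).
    apply: sup_ge => //; exists G => //; split => // p q l Xp Xq /andP[pq qs].
    by apply: GP => //; rewrite pq (le_trans qs).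
  by have := GP s t k Xs Xt; rewrite st lexx => /(_ isT uk); lra.
- suff : sup (E s) <= sup (E t) - k * (t - s) by lra.
  apply: ge_sup => // x [G [Gc GP] ->].
  pose G' r := if r <= s then G r else G s + k * (r - s).
  suff : E t (G s + k * (t - s)) by move=> /(sup_ge _ _ Xt); lra.
  exists G'; last first.
    rewrite /G'; case: ifPn => // ts; have -> : t = s by lra.
    by rewrite subrr mulr0 addr0.
  split; first by rewrite /G' cX.
  move=> p q l Xp Xq /andP[pq qt] ul; rewrite /G'.
  have kl r : X r -> s <= r -> p <= r < q -> k <= l.
    move=> Xr sr /andP[pr rq]; apply: (@le_trans _ _ (u r)).
      by apply: uk => //; rewrite sr (lt_le_trans rq).
    by apply: ul => //; rewrite pr.
  have [qs|sq] := leP q s.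
    by rewrite (le_trans pq qs); apply: GP => //; rewrite pq.
  have [ps|sp] := leP p s.
    have := kl s Xs (lexx _); rewrite ps sq => /(_ isT) {}kl.
    have : k * (q - s) <= l * (q - s) by rewrite ler_wpM2r// subr_ge0 ltW.
    have := GP p s l Xp Xs; rewrite ps lexx => /(_ isT) H.
    have := H _ => /(_ _)-/(_ ltac:(move=> r Xr /andP[pr rs]; apply: ul => //;
      rewrite pr (lt_trans rs))); lra.
  have [->|qp] := eqVneq p q; first by rewrite !subrr mulr0.
  have {}pq : p < q by rewrite lt_neqAle qp.
  have := kl p Xp (ltW sp); rewrite lexx pq => /(_ isT) {}kl.
  have : k * (q - p) <= l * (q - p) by rewrite ler_wpM2r// subr_ge0 ltW.
  by lra.
Qed.

(** The primitive of [darboux_primitive] grows between [t] and a point [r] near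
    [t] with a slope close to [u t] if [u] is continuous at [t]. At a
    right-scattered [t] the interval [[t, sigma t)] contains only [t], so the
    increment to [sigma t] is exactly [u t * (sigma t - t)], and the Lipschitz
    bound absorbs the part between [r] and [t]. *)
Lemma bounded_delta_integrable (R : realType) (T : set R) (a b K : R)
    (u : R -> R) :
  closed T -> T a -> T b -> a <= b ->
  (forall t, ts_itv T a b t -> `|u t| <= K) ->
  (forall t, ts_itv T a b t -> t < b -> sigma (ts_itv T a b) t = t ->
    cont_at (ts_itv T a b) u t) ->
  delta_integrable T a b u.
Proof.
move=> Tc Ta Tb ab uK uc; set X := ts_itv T a b in uK uc *.
have Xa : X a by split => //; rewrite lexx.
have Xb : X b by split => //; rewrite lexx ab.
have [|F FP] := @darboux_primitive _ X a K u Xa _ uK.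
  by move=> r [_ /andP[]].
have K0 : 0 <= K by apply: le_trans (uK _ Xa).
have near_lin s t k e : 0 <= e -> X s -> X t ->
    (forall r, X r -> Num.min s t <= r < Num.max s t -> `|u r - k| <= e) ->
    `|F t - F s - k * (t - s)| <= e * `|t - s|.
  move=> e0; wlog st : s t / s <= t.
    move=> H Xs Xt uk; have [/H|/ltW ts] := leP s t; first exact.
    rewrite distrC (distrC t).
    rewrite (_ : k * _ - _ = F s - F t - k * (s - t)); last by ring.
    by apply: H => // r Xr; rewrite minC maxC; exact: uk.
  move=> Xs Xt; rewrite min_l// max_r// => uk.
  rewrite (ger0_norm (_ : 0 <= t - s)) ?subr_ge0//; apply/ler_normlP.
  have [+ _] := FP s t (k + e) Xs Xt st; have [_ +] := FP s t (k - e) Xs Xt st.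
  move=> lowF upF; split.
  - suff : (k - e) * (t - s) <= F t - F s by lra.
    by apply: lowF => r Xr sr; have /ler_normlP[] := uk r Xr sr; lra.
  - suff : F t - F s <= (k + e) * (t - s) by lra.
    by apply: upF => r Xr sr; have /ler_normlP[] := uk r Xr sr; lra.
have lipF s t : X s -> X t -> `|F t - F s| <= K * `|t - s|.
  move=> Xs Xt; have := @near_lin s t 0 K K0 Xs Xt.
  by rewrite mul0r subr0; apply=> r Xr _; rewrite subr0 uK.
exists F; split.
  apply/within_cont_at => t Xt e e0; have K1 : 0 < K + 1 by lra.
  exists (e / (K + 1)); first by rewrite divr_gt0.
  move=> r Xr; rewrite ltr_pdivlMr// => rt.
  by have := lipF _ _ Xt Xr; have := normr_ge0 (r - t); lra.
move=> t Tt tab; have Xt : X t.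
  by split => //; case/andP: tab => -> /ltW ->.
have tb : t < b by case/andP: tab.
apply/is_delta_derivP => e e0; rewrite -/X.
have [sl|sr] := leP (sigma X t) t.
  have sE : sigma X t = t by apply/eqP; rewrite eq_le sl le_sigma.
  have [d d0 dP] := uc t Xt tb sE e e0.
  exists d => // r Xr rt; rewrite sE; apply: near_lin => //; first exact: ltW.
  move=> q Xq /andP[q1 q2]; apply: dP => //.
  apply: le_lt_trans rt; move: q1 q2.
  have [rt|tr] := leP r t => q1 q2.
    rewrite ler0_norm ?subr_le0 ?(ltW q2)//.
    by rewrite ler0_norm ?subr_le0 ?(le_trans q1 (ltW q2))//; lra.
  by rewrite !ger0_norm ?subr_ge0//; lra.
have Xs : X (sigma X t) by apply: sigma_in => //; exact: ts_itv_closed.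
have := @near_lin t (sigma X t) (u t) 0 (lexx _) Xt Xs.
rewrite min_l ?max_r ?(ltW sr)// mul0r normr_le0 subr_eq0 => /(_ _)/eqP/=.
move=> /(_ ltac:(move=> r Xr /andP[]; rewrite le_eqVlt => /predU1P[<- _|
  /(sigma_le Xr)]; [by rewrite subrr normr0|by rewrite leNgt => /negbTE->])) Fs.
set m := sigma X t - t in Fs; have m0 : 0 < m by rewrite subr_gt0.
have K1 : 0 < 2 * K + 1 by lra.
exists (Num.min (m / 2) (e * (m / 2) / (2 * K + 1))).
  by rewrite lt_min !divr_gt0 ?mulr_gt0// divr_gt0.
move=> r Xr; rewrite lt_min ltr_pdivlMr// => /andP[rt1 rt2].
rewrite (_ : _ - _ = (F t - F r) - u t * (t - r)); last first.
  by move: Fs; rewrite /m; lra.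
apply: le_trans (ler_normB _ _) _; rewrite normrM (distrC t r).
have := lipF _ _ Xr Xt; rewrite (distrC t r) => lip.
have : `|u t| * `|r - t| <= K * `|r - t| by rewrite ler_wpM2r// uK.
have : m / 2 <= `|sigma X t - r|.
  by move: rt1 (ler_norm (sigma X t - r)) (ler_norm (r - t)); rewrite /m; lra.
move=> /(ler_wpM2l (ltW e0)).
move: rt2; rewrite ltr_pdivlMr// => rt2.
have := normr_ge0 (r - t).
lra.
Qed.

(** * Rd-continuity with respect to a family of one-sided limits *)

(** A set [space] with a family of filters, the sides, from which a point of it
    may be approached. The side of a time-scale point is left or right; the
    sides of a point in a product are the products of sides, which correspond
    to the subsets [L] of coordinates approached from the left. Rd-continuity
    asks for a limit along every side, which is the value at the centre when
    [limit_is_value] holds. The last field says that each point has a side that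
    contains the point itself. This makes the passage from functions of [n + 1]
    variables to functions of [n] variables a single lemma. A side filter may be
    improper and then imposes no condition: this is the case of the left side of
    a point that is not left-dense. *)
Record sided_space (Q : Type) := SidedSpace {
  side : Type;
  approach : side -> set_system Q;
  centre : side -> Q;
  limit_is_value : side -> Prop;
  space : set Q;
  approach_filter : forall i, Filter (approach i);
  approach_space : forall i, approach i space;
  centre_space : forall i, space (centre i);
  full_side : forall q, space q -> exists i,
    [/\ centre i = q, limit_is_value i & forall N, approach i N -> N q] }.

Definition rd_continuous (R : realType) (Q : Type) (B : sided_space Q)
    (h : Q -> R) : Prop :=
  forall i : side B, exists v : R,
    h q @[q --> approach i] --> v /\ (limit_is_value i -> v = h (centre i)).

Section TimeScaleSides.
Context {R : realType} (X : set R).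

Definition ts_side : Type := ({p : R | X p} * bool)%type.

Definition ts_approach (i : ts_side) : set_system R :=
  within [set r | X r /\ on_side i.2 (sval i.1) r] (nbhs (sval i.1)).

Lemma ts_approachP (i : ts_side) (P : R -> Prop) :
  ts_approach i P <-> exists2 d, 0 < d & forall r, X r ->
    on_side i.2 (sval i.1) r -> `|r - sval i.1| < d -> P r.
Proof.
rewrite /ts_approach; split=> [/near_withinP[d d0 dP]|[d d0 dP]].
  by exists d => // r Xr ir; exact: dP.
by apply/near_withinP; exists d => // r [Xr ir]; exact: dP.
Qed.

Fact ts_approach_filter i : Filter (ts_approach i).
Proof. exact: within_filter. Qed.

Fact ts_approach_space i : ts_approach i X.
Proof. by apply/ts_approachP; exists 1. Qed.

Fact ts_full_side q : X q -> exists i : ts_side,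
  [/\ sval i.1 = q, i.2 -> right_dense X (sval i.1)
    & forall N, ts_approach i N -> N q].
Proof.
move=> Xq; exists (exist X q Xq, false); split => // N /ts_approachP[d d0].
move=> H; apply: H => /=; [|exact: lexx|rewrite subrr normr0]; done.
Qed.

Definition ts_sided : sided_space R :=
  @SidedSpace _ ts_side ts_approach (fun i => sval i.1)
    (fun i => i.2 -> right_dense X (sval i.1)) X
    ts_approach_filter ts_approach_space (fun i => proj2_sig i.1) ts_full_side.

End TimeScaleSides.

Section ProductSides.
Context (Q S : Type) (B : sided_space Q) (C : sided_space S).

Definition prod_approach (i : side B * side C) : set_system (Q * S) :=
  filter_prod (approach i.1) (approach i.2).

Fact prod_approach_filter i : Filter (prod_approach i).
Proof.
by apply: filter_prod_filter; exact: approach_filter.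
Qed.

Fact prod_approach_space i : prod_approach i (space B `*` space C).
Proof.
by exists (space B, space C) => //=; split; exact: approach_space.
Qed.

Fact prod_full_side q : (space B `*` space C) q ->
  exists i : side B * side C,
  [/\ (centre i.1, centre i.2) = q, limit_is_value i.1 /\ limit_is_value i.2
    & forall N, prod_approach i N -> N q].
Proof.
case: q => q s [/= Bq Cs]; have [i [iq ci iN]] := full_side Bq.
have [j [js cj jN]] := full_side Cs.
exists (i, j); split => //=; first by rewrite iq js.
by move=> N [[A D] /= [/iN Aq /jN Ds]]; apply.
Qed.

Lemma prod_approach_set0 (i : side B * side C) :
  approach i.1 set0 \/ approach i.2 set0 -> prod_approach i set0.
Proof.
have F1 := approach_filter i.1; have F2 := approach_filter i.2.
case=> i0; [exists (set0, setT) | exists (setT, set0)] => /=.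
- by split => //; exact: filterT.
- by move=> q [].
- by split => //; exact: filterT.
- by move=> q [].
Qed.

Definition prod_sided : sided_space (Q * S) :=
  @SidedSpace _ _ prod_approach (fun i => (centre i.1, centre i.2))
    (fun i => limit_is_value i.1 /\ limit_is_value i.2) (space B `*` space C)
    prod_approach_filter prod_approach_space
    (fun i => conj (centre_space i.1) (centre_space i.2)) prod_full_side.

End ProductSides.

Lemma approach_cvg (R : realType) (Q : Type) (B : sided_space Q) (i : side B)
    (h : Q -> R) (v : R) :
  h q @[q --> approach i] --> v <->
  forall e, 0 < e -> approach i [set q | `|h q - v| <= e].
Proof.
have iF := approach_filter i; split.
  move=> /cvgrPdist_le H e e0; apply: filterS (H _ e0) => q.
  by rewrite /= distrC.
move=> H; apply/cvgrPdist_le => e e0; apply: filterS (H _ e0) => q.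
by rewrite /= distrC.
Qed.

Lemma rd_slice (R : realType) (Q S : Type) (B : sided_space Q)
    (C : sided_space S) (h : Q * S -> R) (q : Q) :
  rd_continuous (prod_sided B C) h -> space B q ->
  rd_continuous C (fun s => h (q, s)).
Proof.
move=> hrd Bq j; have [i [iq ci iN]] := full_side Bq.
have [v [/approach_cvg hv cv]] := hrd (i, j); exists v; split; last first.
  by move=> cj; rewrite cv//= iq.
apply/approach_cvg => e /hv[[A D] /= [/iN Aq Dj] AD].
by have jF := approach_filter j; apply: filterS Dj => s Ds; exact: (AD (q, s)).
Qed.

Lemma sides_near (R : realType) (X : set R) (p : R) (Xp : X p) (P : R -> Prop) :
  (forall l, approach ((exist X p Xp, l) : side (ts_sided X)) P) ->
  exists2 d, 0 < d & forall r, X r -> `|r - p| < d -> P r.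
Proof.
move=> H; have /ts_approachP[/= d1 d10 H1] := H true.
have /ts_approachP[/= d2 d20 H2] := H false.
exists (Num.min d1 d2) => [|r Xr]; first by rewrite lt_min d10.
rewrite lt_min => /andP[r1 r2].
by have [pr|rp] := leP p r; [exact: H2|exact: H1].
Qed.

(** Near each point the function stays close to its two one-sided limits, so
    it is bounded by compactness; at right-dense points these two limits are
    the value. *)
Lemma rd_delta_integrable (R : realType) (T : set R) (a b : R) (u : R -> R) :
  closed T -> T a -> T b -> a <= b ->
  rd_continuous (ts_sided (ts_itv T a b)) u -> delta_integrable T a b u.
Proof.
move=> Tc Ta Tb ab urd.
have : near_covering_within (ts_itv T a b).
  by apply/near_covering_withinP/compact_near_coveringP; exact: ts_itv_compact.
set X := ts_itv T a b in urd * => cX.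
have [K uK] : exists K, forall t, X t -> `|u t| <= K.
  have : \forall M \near +oo, X `<=` [set t | `|u t| <= M].
    apply: (cX _ _ (fun M t => `|u t| <= M)) => t Xt.
    pose v l := sval (cid (urd (exist X t Xt, l))).
    have [d d0 dP] : exists2 d, 0 < d & forall r, X r -> `|r - t| < d ->
        `|u r| <= `|v true| + `|v false| + 1.
      apply: (sides_near (Xp := Xt)) => l.
      have [/approach_cvg/(_ _ ltr01) H _] :=
        svalP (cid (urd (exist X t Xt, l))).
      have iF := approach_filter ((exist X t Xt, l) : side (ts_sided X)).
      apply: filterS H => r; rewrite -/(v l) => /= H.
      have : `|u r| <= `|v l| + `|u r - v l|.
        by apply: le_trans (ler_normD _ _); rewrite subrKC.
      have := normr_ge0 (v (~~ l)).
      by clear iF; case: l H => /=; lra.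
    exists (ball t d, [set M | `|v true| + `|v false| + 1 <= M]) => /=.
      by split; [exact: nbhsx_ballx|apply: nbhs_pinfty_ge; exact: num_real].
    move=> [r M] /= [tr vM] Xr; apply: le_trans vM; apply: dP => //.
    by rewrite distrC.
  by move=> [M [_ MP]]; exists (M + 1) => t; apply: MP; rewrite ltrDl.
apply: (bounded_delta_integrable Tc Ta Tb ab uK) => t Xt tb st e e0.
apply: (sides_near (Xp := Xt)) => l.
have [v [/approach_cvg/(_ _ e0) H cv]] := urd (exist X t Xt, l).
have <- : v = u t; last exact: H.
apply: cv => _; split => //.
apply: (@lt_le_trans _ _ b%:E); first by rewrite lte_fin.
by apply: ereal_sup_ubound; exists b => //; split => //; rewrite lexx ab.
Qed.

(** For each [z] the joint limits along [i] and the two sides of [z] make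
    [h (q, r) - h (q', r)] small for [q, q'] late in [i] and [r] near [z];
    compactness of [X] makes the estimate uniform. *)
Lemma rd_uniform_cauchy (R : realType) (Q : Type) (B : sided_space Q)
    (X : set R) (h : Q * R -> R) (i : side B) (e : R) :
  compact X -> rd_continuous (prod_sided B (ts_sided X)) h -> 0 < e ->
  exists2 N, approach i N & forall q q' z, N q -> N q' -> X z ->
    `|h (q, z) - h (q', z)| <= e.
Proof.
move=> /compact_near_coveringP/near_covering_withinP cX hrd e0.
have iF := approach_filter i.
have e20 : 0 < e / 2 by lra.
have : \forall qq \near filter_prod (approach i) (approach i),
    X `<=` [set z | `|h (qq.1, z) - h (qq.2, z)| <= e].
  apply: (cX _ _ (fun qq z => `|h (qq.1, z) - h (qq.2, z)| <= e)) => z Xz.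
  have H l : exists N, approach i N /\ exists D,
      approach ((exist X z Xz, l) : side (ts_sided X)) D /\
      forall q q' r, N q -> N q' -> D r -> `|h (q, r) - h (q', r)| <= e.
    have [v [/approach_cvg/(_ _ e20)[[N D] /= [Ni Dj] ND] _]] :=
      hrd (i, (exist X z Xz, l)).
    exists N; split => //; exists D; split => // q q' r Nq Nq' Dr.
    have := ND (q, r) (conj Nq Dr); have := ND (q', r) (conj Nq' Dr).
    move=> /= H1 H2.
    rewrite (_ : _ - _ = h (q, r) - v - (h (q', r) - v)); last by ring.
    by apply: le_trans (ler_normB _ _) _; lra.
  have [N1 [N1i [D1 [D1j H1]]]] := H true.
  have [N2 [N2i [D2 [D2j H2]]]] := H false.
  have [d d0 dP] : exists2 d, 0 < d & forall r, X r -> `|r - z| < d ->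
      forall q q', (N1 `&` N2) q -> (N1 `&` N2) q' ->
      `|h (q, r) - h (q', r)| <= e.
    apply: (sides_near (Xp := Xz)) => l.
    have jF := approach_filter ((exist X z Xz, l) : side (ts_sided X)).
    case: l jF => jF.
      by apply: filterS D1j => r Dr q q' [Nq _] [Nq' _]; exact: H1.
    by apply: filterS D2j => r Dr q q' [_ Nq] [_ Nq']; exact: H2.
  exists (ball z d, (N1 `&` N2) `*` (N1 `&` N2)) => /=.
    split; first exact: nbhsx_ballx.
    by exists (N1 `&` N2, N1 `&` N2) => //=; split; exact: filterI.
  by move=> [r [q q']] /= [zr [Nq Nq']] Xr; apply: dP => //; rewrite distrC.
move=> [[N1 N2] /= [N1i N2i] NP]; exists (N1 `&` N2); first exact: filterI.
by move=> q q' z [Nq _] [_ Nq'] Xz; exact: (NP (q, q')).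
Qed.

(** Integrating out one variable preserves rd-continuity. By
    [rd_uniform_cauchy] the integrals form a Cauchy family along each side.
    When the limit has to be the value at the centre, the uniform Cauchy
    estimate is passed to the limit in [q'] at each fixed [z], along the right
    side of [z]. This side contains [z] itself, so [h (q', z)] tends to
    [h (centre i, z)]. *)
Lemma rd_delta_integral (R : realType) (Q : Type) (B : sided_space Q)
    (T : set R) (a b : R) (h : Q * R -> R) :
  closed T -> T a -> T b -> a <= b ->
  rd_continuous (prod_sided B (ts_sided (ts_itv T a b))) h ->
  rd_continuous B (fun q => delta_integral T a b (fun z => h (q, z))).
Proof.
move=> Tc Ta Tb ab hrd i; have iF := approach_filter i.
set H := fun q => delta_integral T a b (fun z => h (q, z)).
rewrite -/(H (centre i)); have [i0|ni0] := pselect (approach i set0).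
  exists (H (centre i)); split => //; apply/approach_cvg => e e0.
  exact: filterS i0.
have iP : ProperFilter (approach i) by exact: Build_ProperFilter.
set X := ts_itv T a b in hrd *.
have D0 : 0 < b - a + 1 by lra.
have Hi q : space B q -> delta_integrable T a b (fun z => h (q, z)).
  by move=> Bq; apply: rd_delta_integrable => //; exact: rd_slice Bq.
have Hle q q' e : space B q -> space B q' ->
    (forall z, X z -> `|h (q, z) - h (q', z)| <= e) ->
    `|H q - H q'| <= e * (b - a).
  move=> Bq Bq' hqq'; apply/ler_normlP; split.
  - suff : H q' <= 1 * H q + e * (b - a) by lra.
    apply: delta_integral_growth_le => //; [exact: Hi|exact: Hi|move=> z Xz].
    by have /ler_normlP[] := hqq' z Xz; lra.
  - suff : H q <= 1 * H q' + e * (b - a) by lra.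
    apply: delta_integral_growth_le => //; [exact: Hi|exact: Hi|move=> z Xz].
    by have /ler_normlP[] := hqq' z Xz; lra.
have scale e : 0 < e -> 0 < e / (b - a + 1) /\ e / (b - a + 1) * (b - a) < e.
  move=> e0; have k0 : 0 < e / (b - a + 1) by rewrite divr_gt0.
  have : e / (b - a + 1) * (b - a + 1) = e by field; rewrite gt_eqF.
  by split => //; lra.
have cX : compact X by exact: ts_itv_compact.
have Hcvg : cvg (H q @[q --> approach i]).
  apply/cauchy_cvgP/cauchy_exP => e e0; have [k0 ke] := scale _ e0.
  have [N Ni NP] := rd_uniform_cauchy i cX hrd k0.
  have NBi : approach i (N `&` space B).
    by apply: filterI => //; exact: approach_space.
  have [q0 [Nq0 Bq0]] := filter_ex NBi.
  exists (H q0); apply: filterS NBi => q [Nq Bq].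
  by rewrite /ball/=; apply: le_lt_trans ke; apply: Hle => // z Xz; exact: NP.
exists (lim (H q @[q --> approach i])); split => // ci.
apply: cvg_lim => //; apply/approach_cvg => e e0; have [k0 ke] := scale _ e0.
have [N Ni NP] := rd_uniform_cauchy i cX hrd k0.
have NBi : approach i (N `&` space B).
  by apply: filterI => //; exact: approach_space.
apply: filterS NBi => q [Nq Bq] /=; apply: le_trans (ltW ke).
apply: Hle => // [|z Xz]; first exact: centre_space.
apply/ler_addgt0Pr => eta eta0.
have [v [/approach_cvg/(_ _ eta0)[[A D] /= [Ai Dj] AD] cv]] :=
  hrd (i, (exist X z Xz, false)).
have {}cv : v = h (centre i, z) by apply: cv.
have Dz : D z.
  have /ts_approachP[d d0 dP] := Dj.
  by apply: dP => //=; [exact: lexx|rewrite subrr normr0].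
have [q' [Nq' Aq']] := filter_ex (filterI Ni Ai).
have := AD (q', z) (conj Aq' Dz); have := NP q q' z Nq Nq' Xz; rewrite /= cv.
rewrite (_ : h (q, z) - h (centre i, z) =
  (h (q, z) - h (q', z)) + (h (q', z) - h (centre i, z))); last by ring.
by move=> H1 H2; apply: le_trans (ler_normD _ _) _; lra.
Qed.

(** * Rd-continuity on a box *)

Lemma rd_weighted_norms (R : realType) (Q : Type) (B : sided_space Q)
    (f g : Q -> R) (k l : R) :
  rd_continuous B f -> rd_continuous B g ->
  rd_continuous B (fun q => `|g q| * k + `|f q| * l).
Proof.
move=> frd grd i; have iF := approach_filter i.
have [v [fv cv]] := frd i; have [w [gw cw]] := grd i.
exists (`|w| * k + `|v| * l); split => [|ci]; last by rewrite cv// cw.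
by apply: cvgD; apply: cvgMl; exact: cvg_norm.
Qed.

Lemma not_left_dense_isolated (R : realType) (X : set R) (p : R) :
  X p -> ~ left_dense X p ->
  exists2 d, 0 < d & forall r, X r -> r < p -> `|r - p| < d -> False.
Proof.
move=> Xp nl; have [H|H] := pselect (exists2 r, X r & r < p); last first.
  by exists 1 => // r Xr rp _; apply: H; exists r.
have rp : rho X p < p.
  rewrite lt_neqAle rho_le andbT; apply/negP => /eqP rE; apply: nl; split => //.
  have [r Xr rp] := H; apply: (@le_lt_trans _ _ r%:E); last by rewrite lte_fin.
  by apply: ereal_inf_lbound; exists r.
exists (p - rho X p) => [|r Xr rp']; first by rewrite subr_gt0.
by have := le_rho Xr rp'; rewrite distrC gtr0_norm ?subr_gt0//; lra.
Qed.

Lemma right_dense_sub (R : realType) (T : set R) (a b c p : R) :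
  a <= c -> ts_itv T c b p -> right_dense (ts_itv T c b) p ->
  right_dense (ts_itv T a b) p.
Proof.
move=> ac [Tp /andP[cp pb]] [ps sp]; split.
  apply: lt_le_trans ps _; apply: le_ereal_sup => _ [r [Tr /andP[cr rb]] <-].
  by exists r => //; split => //; rewrite rb (le_trans ac).
rewrite -[RHS]sp /sigma.
have -> : [set r | ts_itv T a b r /\ p < r] = [set r | ts_itv T c b r /\ p < r].
  apply/seteqP; split => r [[Tr /andP[r1 r2]] pr]; split => //; split => //.
    by rewrite r2 (le_trans cp (ltW pr)).
  by rewrite r2 (le_trans ac).
congr (if _ then _ else _); apply: asbool_equiv_eq.
split => -[r [Tr /andP[r1 r2]] pr].
  by exists r => //; split => //; rewrite r2 (le_trans cp (ltW pr)).
by exists r => //; split => //; rewrite r2 (le_trans ac).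
Qed.

(** Rd-continuity on a box restricts to a box with the same upper corner: left
    and right sides only become finer, and a point that is right-dense in the
    smaller interval is so in the larger one. A side that approaches a
    coordinate from the left is improper if this coordinate is not
    left-dense. *)
Lemma rd_continuous_box (R : realType) (T1 T2 T3 : set R)
    (a1 b1 c1 a2 b2 c2 a3 b3 c3 : R) (f : R -> R -> R -> R) :
  a1 <= c1 -> a2 <= c2 -> a3 <= c3 ->
  rd_continuous3 (ts_itv T1 a1 b1) (ts_itv T2 a2 b2) (ts_itv T3 a3 b3) f ->
  rd_continuous (prod_sided (prod_sided (ts_sided (ts_itv T1 c1 b1))
      (ts_sided (ts_itv T2 c2 b2))) (ts_sided (ts_itv T3 c3 b3)))
    (fun q => f q.1.1 q.1.2 q.2).
Proof.
move=> ac1 ac2 ac3 frd [[[[p1 X1] l1] [[p2 X2] l2]] [[p3 X3] l3]].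
set B := prod_sided _ _.
pose i : side B :=
  (((exist _ p1 X1, l1), (exist _ p2 X2, l2)), (exist _ p3 X3, l3)).
change (exists v : R, f q.1.1 q.1.2 q.2 @[q --> approach i] --> v /\
  (limit_is_value i -> v = f p1 p2 p3)).
have iF := approach_filter i.
have side0 (T : set R) a b c p (l : bool) (Xp : ts_itv T c b p) : a <= c ->
    ~ (l -> left_dense (ts_itv T a b) p) ->
    approach ((exist _ p Xp, l) : side (ts_sided (ts_itv T c b))) set0.
  case: l => [ac nl|_ []//].
  have [||d d0 dP] := @not_left_dense_isolated _ (ts_itv T a b) p.
  - exact: ts_itv_sub Xp.
  - by move=> L; apply: nl.
  apply/ts_approachP; exists d => //= r Xr rp rd; apply: (dP r) => //.
  exact: ts_itv_sub Xr.
have [i0|ni0] := pselect (approach i set0).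
  exists (f p1 p2 p3); split => //; apply/approach_cvg => e e0.
  exact: filterS i0.
have [L1|/(side0 _ _ _ _ _ _ X1 ac1)L1] :=
  pselect (l1 -> left_dense (ts_itv T1 a1 b1) p1); last first.
  case: ni0; apply: prod_approach_set0; left.
  by apply: prod_approach_set0; left.
have [L2|/(side0 _ _ _ _ _ _ X2 ac2)L2] :=
  pselect (l2 -> left_dense (ts_itv T2 a2 b2) p2); last first.
  case: ni0; apply: prod_approach_set0; left.
  by apply: prod_approach_set0; right.
have [L3|/(side0 _ _ _ _ _ _ X3 ac3)L3] :=
  pselect (l3 -> left_dense (ts_itv T3 a3 b3) p3); last first.
  by case: ni0; apply: prod_approach_set0; right.
have [v [fv cv]] := frd p1 p2 p3 l1 l2 l3 (ts_itv_sub ac1 X1)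
  (ts_itv_sub ac2 X2) (ts_itv_sub ac3 X3) L1 L2 L3.
exists v; split; last first.
  move=> [[/= r1 r2] r3]; apply: cv => /[dup] l.
  - by move=> /r1; exact: right_dense_sub.
  - by move=> /r2; exact: right_dense_sub.
  - by move=> /r3; exact: right_dense_sub.
apply/approach_cvg => e e0; move/cvgrPdist_le: fv => /(_ _ e0).
rewrite near_withinE => /nbhs_ballP[d /= d0 dP].
pose A (T : set R) b c p (l : bool) :=
  [set r | [/\ ts_itv T c b r, on_side l p r & `|r - p| < d]].
have AP (T : set R) b c p (l : bool) (Xp : ts_itv T c b p) :
    approach ((exist _ p Xp, l) : side (ts_sided (ts_itv T c b))) (A T b c p l).
  by apply/ts_approachP; exists d.
exists (A T1 b1 c1 p1 l1 `*` A T2 b2 c2 p2 l2, A T3 b3 c3 p3 l3) => /=.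
  split; last exact: AP.
  by exists (A T1 b1 c1 p1 l1, A T2 b2 c2 p2 l2) => //=; split; exact: AP.
move=> [[q1 q2] q3] /= [[[Y1 s1 D1] [Y2 s2 D2]] [Y3 s3 D3]] /=.
rewrite distrC; apply: (dP ((q1, q2), q3)).
  by split; [split|]; rewrite /ball/= distrC.
split; split => //=.
- exact: ts_itv_sub Y1.
- exact: ts_itv_sub Y2.
- exact: ts_itv_sub Y3.
Qed.

(** * Mixed differences and the trapezoid error *)

Lemma delta_deriv_is (R : realType) (X : set R) (u : R -> R) (t : R) :
  delta_derivable X u t -> is_delta_deriv X u t (delta_deriv X u t).
Proof. by move=> H; exact: (@xgetPex _ 0 [set d | is_delta_deriv X u t d]). Qed.

(** The mean value inequality is used once in each variable: the alternating
    sum over the eight vertices is an increment in the first variable whose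
    delta derivative is an alternating sum over four vertices, and so on. *)
Lemma mixed_difference_le (R : realType) (X1 X2 X3 : set R)
    (f : R -> R -> R -> R) (M : R) :
  closed X1 -> closed X2 -> closed X3 -> mixed_delta_exists X1 X2 X3 f ->
  (forall x y z, kappa X1 x -> kappa X2 y -> kappa X3 z ->
    `|mixed_delta X1 X2 X3 f x y z| <= M) ->
  forall x y z u1 u2 u3, X1 x -> X2 y -> X3 z -> X1 u1 -> X2 u2 -> X3 u3 ->
  `|(f x y z - f x y u3 - (f x u2 z - f x u2 u3))
    - (f u1 y z - f u1 y u3 - (f u1 u2 z - f u1 u2 u3))|
  <= M * `|z - u3| * `|y - u2| * `|x - u1|.
Proof.
move=> C1 C2 C3 [D1 D2 D3] fM x y z u1 u2 u3 Xx Xy Xz Xu1 Xu2 Xu3.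
apply: (@delta_lipschitz _ X1 (fun r =>
  f r y z - f r y u3 - (f r u2 z - f r u2 u3))) => // r1 K1.
exists (pdelta1 X1 f r1 y z - pdelta1 X1 f r1 y u3
        - (pdelta1 X1 f r1 u2 z - pdelta1 X1 f r1 u2 u3)); last first.
  by do 2!apply: is_delta_derivB; apply: delta_deriv_is; exact: D1.
apply: (@delta_lipschitz _ X2 (fun r =>
  pdelta1 X1 f r1 r z - pdelta1 X1 f r1 r u3)) => // r2 K2.
exists (pdelta2 X2 (pdelta1 X1 f) r1 r2 z
        - pdelta2 X2 (pdelta1 X1 f) r1 r2 u3); last first.
  by apply: is_delta_derivB; apply: delta_deriv_is; exact: D2.
apply: (@delta_lipschitz _ X3) => // r3 K3.
exists (mixed_delta X1 X2 X3 f r1 r2 r3); first exact: fM.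
by apply: delta_deriv_is; exact: D3.
Qed.

(** [8 * (f - opA f)] at [(x, y, z)] is the sum over the eight vertices
    [(u1, u2, u3)] of the large box of the alternating sums of [f] over the
    boxes spanned by [(x, y, z)] and [(u1, u2, u3)]. These small boxes tile
    the large one, hence the volume factor. *)
Lemma opA_error_le (R : realType) (X1 X2 X3 : set R) (f : R -> R -> R -> R)
    (M c1 d1 c2 d2 c3 d3 x y z : R) :
  closed X1 -> closed X2 -> closed X3 -> mixed_delta_exists X1 X2 X3 f ->
  (forall x y z, kappa X1 x -> kappa X2 y -> kappa X3 z ->
    `|mixed_delta X1 X2 X3 f x y z| <= M) ->
  X1 c1 -> X1 d1 -> X2 c2 -> X2 d2 -> X3 c3 -> X3 d3 ->
  X1 x -> X2 y -> X3 z -> c1 <= x <= d1 -> c2 <= y <= d2 -> c3 <= z <= d3 ->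
  `|f x y z - opA c1 d1 c2 d2 c3 d3 f x y z|
  <= 8^-1 * ((d1 - c1) * (d2 - c2) * (d3 - c3)) * M.
Proof.
move=> C1 C2 C3 De fM Xc1 Xd1 Xc2 Xd2 Xc3 Xd3 Xx Xy Xz.
move=> /andP[cx xd] /andP[cy yd] /andP[cz zd].
pose D u1 u2 u3 := (f x y z - f x y u3 - (f x u2 z - f x u2 u3))
    - (f u1 y z - f u1 y u3 - (f u1 u2 z - f u1 u2 u3)).
have DP u1 u2 u3 : X1 u1 -> X2 u2 -> X3 u3 ->
    `|D u1 u2 u3| <= M * `|z - u3| * `|y - u2| * `|x - u1|.
  by move=> *; exact: (mixed_difference_le C1 C2 C3 De fM).
have -> : f x y z - opA c1 d1 c2 d2 c3 d3 f x y z = 8^-1 *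
    (D c1 c2 c3 + D c1 c2 d3 + D c1 d2 c3 + D c1 d2 d3
     + D d1 c2 c3 + D d1 c2 d3 + D d1 d2 c3 + D d1 d2 d3).
  by rewrite /opA /D; field.
rewrite normrM (ger0_norm (_ : 0 <= 8^-1))// -mulrA ler_wpM2l//.
have := DP _ _ _ Xc1 Xc2 Xc3; have := DP _ _ _ Xc1 Xc2 Xd3.
have := DP _ _ _ Xc1 Xd2 Xc3; have := DP _ _ _ Xc1 Xd2 Xd3.
have := DP _ _ _ Xd1 Xc2 Xc3; have := DP _ _ _ Xd1 Xc2 Xd3.
have := DP _ _ _ Xd1 Xd2 Xc3; have := DP _ _ _ Xd1 Xd2 Xd3.
rewrite (ger0_norm (_ : 0 <= x - c1)) ?subr_ge0//.
rewrite (ger0_norm (_ : 0 <= y - c2)) ?subr_ge0//.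
rewrite (ger0_norm (_ : 0 <= z - c3)) ?subr_ge0//.
rewrite (ler0_norm (_ : x - d1 <= 0)) ?subr_le0//.
rewrite (ler0_norm (_ : y - d2 <= 0)) ?subr_le0//.
rewrite (ler0_norm (_ : z - d3 <= 0)) ?subr_le0//.
move=> /ler_normlP[? ?] /ler_normlP[? ?] /ler_normlP[? ?] /ler_normlP[? ?].
move=> /ler_normlP[? ?] /ler_normlP[? ?] /ler_normlP[? ?] /ler_normlP[? ?].
by apply/ler_normlP; split; lra.
Qed.

Lemma sup_norm3_ge (R : realType) (X1 X2 X3 : set R) (f : R -> R -> R -> R)
    (x y z : R) :
  bounded_on3 X1 X2 X3 f -> X1 x -> X2 y -> X3 z ->
  `|f x y z| <= sup_norm3 X1 X2 X3 f.
Proof.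
move=> [M fM] Xx Xy Xz; apply: ub_le_sup.
  by exists M => _ [[[p q] r] [[/= Xp Xq] Xr] <-]; exact: fM.
by exists ((x, y), z).
Qed.

Lemma kappa_min (R : realType) (T : set R) (a b : R) :
  T a -> T b -> a < b -> kappa (ts_itv T a b) a.
Proof.
move=> Ta Tb ab; split; first by split => //; rewrite lexx ltW.
move=> [/(_ b)/(_ (conj Tb _))]; rewrite lexx (ltW ab) => /(_ isT).
by rewrite leNgt ab.
Qed.

Lemma sigma_itv (R : realType) (T : set R) (a b s : R) :
  closed T -> T b -> T s -> a <= s < b ->
  T (sigma T s) /\ a <= sigma T s <= b.
Proof.
move=> Tc Tb Ts /andP[as_ sb]; split; first exact: sigma_in.
by rewrite (le_trans as_ (le_sigma T s)) sigma_le.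
Qed.

(** The integrand on the left is
    [(f * (g - A g) + g * (f - A f)) / 2], so [opA_error_le] bounds it
    pointwise by a multiple of [|g| * Mf + |f| * Mg]. The latter function and
    its partial integrals are rd-continuous, so they have antiderivatives, and
    [delta_integral_le] applies at each of the three levels. *)
Lemma product_trapezoid_integral_le (R : realType) (T1 T2 T3 : set R)
    (a1 c1 b1 a2 c2 b2 a3 c3 b3 Mf Mg : R) (f g : R -> R -> R -> R) :
  closed T1 -> closed T2 -> closed T3 ->
  T1 c1 -> T1 b1 -> T2 c2 -> T2 b2 -> T3 c3 -> T3 b3 ->
  a1 <= c1 <= b1 -> a2 <= c2 <= b2 -> a3 <= c3 <= b3 ->
  let X1 := ts_itv T1 a1 b1 in
  let X2 := ts_itv T2 a2 b2 in
  let X3 := ts_itv T3 a3 b3 in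
  let A := opA c1 b1 c2 b2 c3 b3 in
  rd_continuous3 X1 X2 X3 f -> rd_continuous3 X1 X2 X3 g ->
  mixed_delta_exists X1 X2 X3 f -> mixed_delta_exists X1 X2 X3 g ->
  0 <= Mf -> 0 <= Mg ->
  (forall x y z, kappa X1 x -> kappa X2 y -> kappa X3 z ->
    `|mixed_delta X1 X2 X3 f x y z| <= Mf) ->
  (forall x y z, kappa X1 x -> kappa X2 y -> kappa X3 z ->
    `|mixed_delta X1 X2 X3 g x y z| <= Mg) ->
  delta_integral T1 c1 b1 (fun x => delta_integral T2 c2 b2 (fun y =>
    delta_integral T3 c3 b3 (fun z =>
      f x y z * g x y z
      - 2^-1 * (f x y z * A g x y z + g x y z * A f x y z))))
  <= 16^-1 * (b1 - c1) * (b2 - c2) * (b3 - c3)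
     * delta_integral T1 c1 b1 (fun x => delta_integral T2 c2 b2 (fun y =>
         delta_integral T3 c3 b3 (fun z =>
           `|g x y z| * Mf + `|f x y z| * Mg))).
Proof.
move=> cT1 cT2 cT3 Tc1 Tb1 Tc2 Tb2 Tc3 Tb3.
move=> /andP[ac1 cb1] /andP[ac2 cb2] /andP[ac3 cb3].
move=> X1 X2 X3 A frd grd fd gd Mf0 Mg0 fM gM.
pose C := 16^-1 * (b1 - c1) * (b2 - c2) * (b3 - c3).
have C0 : 0 <= C by rewrite /C !mulr_ge0 ?subr_ge0.
pose w x y z := `|g x y z| * Mf + `|f x y z| * Mg.
have w0 x y z : 0 <= w x y z by rewrite /w addr_ge0// mulr_ge0.
have ends (T : set R) a b c : a <= c -> c <= b -> T c -> T b ->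
    ts_itv T a b c /\ ts_itv T a b b.
  move=> ac cb Tc Tb; split; split => //; rewrite ?lexx ?ac ?cb//.
  by rewrite (le_trans ac).
have [Xc1 Xb1] := ends _ _ _ _ ac1 cb1 Tc1 Tb1.
have [Xc2 Xb2] := ends _ _ _ _ ac2 cb2 Tc2 Tb2.
have [Xc3 Xb3] := ends _ _ _ _ ac3 cb3 Tc3 Tb3.
have error h M x y z : mixed_delta_exists X1 X2 X3 h ->
    (forall x y z, kappa X1 x -> kappa X2 y -> kappa X3 z ->
      `|mixed_delta X1 X2 X3 h x y z| <= M) ->
    ts_itv T1 c1 b1 x -> ts_itv T2 c2 b2 y -> ts_itv T3 c3 b3 z ->
    `|h x y z - A h x y z| <= 8^-1 * ((b1 - c1) * (b2 - c2) * (b3 - c3)) * M.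
  move=> hd hM Xx Xy Xz.
  apply: (@opA_error_le _ X1 X2 X3) => //; try exact: ts_itv_closed.
  - exact: ts_itv_sub Xx.
  - exact: ts_itv_sub Xy.
  - exact: ts_itv_sub Xz.
  - by case: Xx.
  - by case: Xy.
  - by case: Xz.
have integrand x y z : ts_itv T1 c1 b1 x -> ts_itv T2 c2 b2 y ->
    ts_itv T3 c3 b3 z ->
    f x y z * g x y z - 2^-1 * (f x y z * A g x y z + g x y z * A f x y z)
    <= C * w x y z.
  move=> Xx Xy Xz; have Ef := error f Mf x y z fd fM Xx Xy Xz.
  have Eg := error g Mg x y z gd gM Xx Xy Xz.
  rewrite (_ : _ - _ = 2^-1 * (f x y z * (g x y z - A g x y z)
    + g x y z * (f x y z - A f x y z))); last by field.
  have := ler_wpM2l (normr_ge0 (g x y z)) Ef.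
  have := ler_wpM2l (normr_ge0 (f x y z)) Eg.
  rewrite -!normrM => /(le_trans (ler_norm _)) + /(le_trans (ler_norm _)).
  by rewrite /C /w; lra.
have wrd : rd_continuous (prod_sided (prod_sided (ts_sided (ts_itv T1 c1 b1))
    (ts_sided (ts_itv T2 c2 b2))) (ts_sided (ts_itv T3 c3 b3)))
    (fun q => w q.1.1 q.1.2 q.2).
  by apply: rd_weighted_norms; apply: rd_continuous_box; eassumption.
have w2rd := rd_delta_integral cT3 Tc3 Tb3 cb3 wrd.
have w1rd := rd_delta_integral cT2 Tc2 Tb2 cb2 w2rd.
rewrite -/C.
apply: delta_integral_le => // [x Xx||x Xx].
- apply: delta_integral_ge0 => // y _.
  by apply: delta_integral_ge0 => // z _; exact: w0.
- exact: rd_delta_integrable w1rd.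
apply: delta_integral_le => // [y Xy||y Xy].
- by apply: delta_integral_ge0 => // z _; exact: w0.
- by apply: rd_delta_integrable => //; exact: (rd_slice w2rd).
apply: delta_integral_le => // [z Xz||z Xz].
- exact: w0.
- by apply: rd_delta_integrable => //; exact: (rd_slice (q := (x, y)) wrd).
exact: integrand.
Qed.

Theorem theorem3p1 (R : realType) (T1 T2 T3 : set R)
    (a1 b1 a2 b2 a3 b3 : R) (f g : R -> R -> R -> R) (s t tau : R) :
  time_scale T1 -> time_scale T2 -> time_scale T3 ->
  T1 a1 -> T1 b1 -> T2 a2 -> T2 b2 -> T3 a3 -> T3 b3 ->
  a1 < b1 -> a2 < b2 -> a3 < b3 ->
  let X1 := ts_itv T1 a1 b1 in
  let X2 := ts_itv T2 a2 b2 in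
  let X3 := ts_itv T3 a3 b3 in
  let K1 := kappa X1 in
  let K2 := kappa X2 in
  let K3 := kappa X3 in
  let f' := mixed_delta X1 X2 X3 f in
  let g' := mixed_delta X1 X2 X3 g in
  let c1 := sigma T1 s in
  let c2 := sigma T2 t in
  let c3 := sigma T3 tau in
  let A := opA c1 b1 c2 b2 c3 b3 in
  rd_continuous3 X1 X2 X3 f -> rd_continuous3 X1 X2 X3 g ->
  mixed_delta_exists X1 X2 X3 f -> mixed_delta_exists X1 X2 X3 g ->
  rd_continuous3 K1 K2 K3 f' -> rd_continuous3 K1 K2 K3 g' ->
  bounded_on3 K1 K2 K3 f' -> bounded_on3 K1 K2 K3 g' ->
  T1 s -> a1 <= s < b1 ->
  T2 t -> a2 <= t < b2 ->
  T3 tau -> a3 <= tau < b3 ->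
  delta_integral T1 c1 b1 (fun x => delta_integral T2 c2 b2 (fun y =>
    delta_integral T3 c3 b3 (fun z =>
      f x y z * g x y z
      - 2^-1 * (f x y z * A g x y z + g x y z * A f x y z))))
  <= 16^-1 * (b1 - c1) * (b2 - c2) * (b3 - c3)
     * delta_integral T1 c1 b1 (fun x => delta_integral T2 c2 b2 (fun y =>
         delta_integral T3 c3 b3 (fun z =>
           `|g x y z| * sup_norm3 K1 K2 K3 f'
           + `|f x y z| * sup_norm3 K1 K2 K3 g'))).
Proof.
move=> [_ cT1] [_ cT2] [_ cT3] Ta1 Tb1 Ta2 Tb2 Ta3 Tb3 ab1 ab2 ab3.
move=> X1 X2 X3 K1 K2 K3 f' g' c1 c2 c3 A frd grd fd gd _ _ fb gb.
move=> Ts sab Tt tab Ttau tauab.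
have [Tc1 cab1] := sigma_itv cT1 Tb1 Ts sab.
have [Tc2 cab2] := sigma_itv cT2 Tb2 Tt tab.
have [Tc3 cab3] := sigma_itv cT3 Tb3 Ttau tauab.
have M0 h : bounded_on3 K1 K2 K3 h -> 0 <= sup_norm3 K1 K2 K3 h.
  move=> hb; apply: (le_trans (normr_ge0 (h a1 a2 a3))).
  by apply: sup_norm3_ge => //; exact: kappa_min.
apply: (@product_trapezoid_integral_le _ T1 T2 T3
  a1 c1 b1 a2 c2 b2 a3 c3 b3) => //.
- exact: (M0 _ fb).
- exact: (M0 _ gb).
- by move=> x y z Kx Ky Kz; exact: (sup_norm3_ge fb).
- by move=> x y z Kx Ky Kz; exact: (sup_norm3_ge gb).
Qed.
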